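(* $\langle\forall^\infty\exists^\infty\rangle\not\le_{\sf m}\langle\forall^\infty\exists\rangle$.
   Context: Quantifiers range over $\omega$. $\exists^\infty n\,\varphi(n)$ means $\forall m\exists n\ge m\,\varphi(n)$ and $\forall^\infty n\,\varphi(n)$ means $\exists m\forall n\ge m\,\varphi(n)$. A quantifier-pattern is a finite string $\bar{\mathsf Q}=\mathsf Q_0\dots\mathsf Q_\ell$ over $\{\exists,\forall,\exists^\infty,\forall^\infty\}$. A $\bar{\mathsf Q}$-formula is $\varphi(\bar x)\equiv\mathsf Q_0n_0\dots\mathsf Q_\ell n_\ell\,\theta(n_0,\dots,n_\ell,\bar x)$ with $\theta$ bounded. The instance $\bar x$ is a tuple of natural numbers and/or total computable functions (computable elements of $\omega^\omega$). Spaces such as $\omega\times\omega^\omega$, $(\omega^\omega)^\omega$, $\omega^{\omega\times\omega}$ are identified with $\omega^\omega$ by computable pairing. Witnesses: for $\alpha\in\omega^\omega$, $\alpha\Vdash\varphi(\bar x)$ (''$\alpha$ is a witness for $\varphi(\bar x)$'') is defined by: $\alpha\Vdash\theta(\bar x)$ iff $\alpha=\bar x$ and $\theta(\bar x)$, for bounded $\theta$; $\langle t,\alpha\rangle\Vdash\exists n\varphi(n,\bar x)$ iff $\alpha\Vdash\varphi(t,\bar x)$; $\alpha\Vdash\forall n\varphi(n,\bar x)$ iff $\alpha(n)\Vdash\varphi(n,\bar x)$ for all $n$; $\langle t,\alpha\rangle\Vdash\forall^\infty n\varphi(n,\bar x)$ iff $\alpha(n)\Vdash\varphi(n,\bar x)$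 for all $n\ge t$; $\alpha\Vdash\exists^\infty n\varphi(n,\bar x)$ iff for all $n$, writing $\alpha(n)=\langle k,\beta\rangle$, $k\ge n$ and $\beta\Vdash\varphi(k,\bar x)$. $\varphi\le_{\sf m}\psi$ if there are computable functions $\eta,r_-,r_+$ (type-two computable functionals, possibly partial but defined wherever required) such that for every instance $\bar x$: $\varphi(\bar x)$ is true iff $\psi(\eta(\bar x))$ is true; $\alpha\Vdash\varphi(\bar x)$ implies $r_-(\alpha,\bar x)\Vdash\psi(\eta(\bar x))$; $\alpha\Vdash\psi(\eta(\bar x))$ implies $r_+(\alpha,\bar x)\Vdash\varphi(\bar x)$ ($\alpha\in\omega^\omega$ arbitrary). $\langle\bar{\mathsf Q}\rangle$ denotes a fixed $\bar{\mathsf Q}$-formula to which every $\bar{\mathsf Q}$-formula is $\le_{\sf m}$-reducible; concretely $\langle\bar{\mathsf Q}\rangle(x)\equiv\mathsf Q_0n_0\dots\mathsf Q_\ell n_\ell.\ x(n_0,\dots,n_\ell)=0$ (the choice does not matter up to $\equiv_{\sf m}$). *)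

(* Defs.v *)
From Stdlib Require Import Arith Cantor List.
Import ListNotations.

Definition baire : Type := nat -> nat.

(** ** Identifications of product spaces with [baire] *)

Definition pair_code (n k : nat) : nat := to_nat (n, k).

(** [pushed t a] is ⟨t, a⟩ under ω × ω^ω ≅ ω^ω; its inverse is
    [a |-> (a 0, tail a)]. *)
Definition pushed (t : nat) (a : baire) : baire :=
  fun k => match k with 0 => t | S k' => a k' end.

Definition tail (a : baire) : baire := fun k => a (S k).

(** [section a n] is the n-th coordinate of [a] under ω^ω ≅ (ω^ω)^ω. *)
Definition section (a : baire) (n : nat) : baire := fun k => a (pair_code n k).

(** ω^ω × ω^ω ≅ ω^ω: [a] on the even positions, [b] on the odd ones. *)
Definition join (a b : baire) : baire :=
  fun k => if Nat.even k then a (Nat.div2 k) else b (Nat.div2 k).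

(** ω^(l+1) ≅ ω, so that [x (tuple_code [n_0; ..; n_l])] is x(n_0, .., n_l);
    the value at [[]] is a dummy. *)
Fixpoint tuple_code (ns : list nat) : nat :=
  match ns with
  | [] => 0
  | n :: ms => match ms with
               | [] => n
               | _ :: _ => pair_code n (tuple_code ms)
               end
  end.

(** ** Computability on ω and on ω^ω *)

(** Codes for partial recursive functions relative to a function oracle.  All
    functions are unary; several arguments are passed through [pair_code]. *)
Inductive code : Type :=
| Zero | Succ | Left | Right | Oracle
| Pair (f g : code)
| Comp (f g : code)
| Prec (f g : code)
| Min (f : code).

(** [eval a c n v]: code [c] with oracle [a] halts on input [n] with value
    [v]. *)
Inductive eval (a : baire) : code -> nat -> nat -> Prop :=
| eval_Zero n : eval a Zero n 0
| eval_Succ n : eval a Succ n (S n)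
| eval_Left n : eval a Left n (fst (of_nat n))
| eval_Right n : eval a Right n (snd (of_nat n))
| eval_Oracle n : eval a Oracle n (a n)
| eval_Pair f g n u v :
    eval a f n u -> eval a g n v -> eval a (Pair f g) n (pair_code u v)
| eval_Comp f g n u v :
    eval a g n u -> eval a f u v -> eval a (Comp f g) n v
| eval_Prec_0 f g p v :
    eval a f p v -> eval a (Prec f g) (pair_code p 0) v
| eval_Prec_S f g p i u v :
    eval a (Prec f g) (pair_code p i) u ->
    eval a g (pair_code p (pair_code i u)) v ->
    eval a (Prec f g) (pair_code p (S i)) v
| eval_Min f p v (u : nat -> nat) :
    eval a f (pair_code p v) 0 ->
    (forall i, i < v -> eval a f (pair_code p i) (S (u i))) ->
    eval a (Min f) p v.

Definition computable (x : baire) : Prop :=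
  exists c, forall n, eval (fun _ => 0) c n (x n).

(** The partial type-two functional with code [c] is defined at [a], with
    value [b]. *)
Definition maps_to (c : code) (a b : baire) : Prop :=
  forall n, eval a c n (b n).

(** ** Formulas and witnesses *)

Inductive quantifier : Type := Ex | All | ExInf | AllInf.

(** The formula Q_0 n_0 .. Q_l n_l. matrix [n_0; ..; n_l] x with instance [x].
    The matrix is not restricted to bounded formulas here; the matrices of the
    formulas [generic] below are. *)
Record formula : Type := Formula {
  pattern : list quantifier;
  matrix : list nat -> baire -> Prop
}.

(** Below, [ns] holds the values of the variables quantified so far, outermost
    first. *)
Fixpoint holds_at (theta : list nat -> baire -> Prop)
    (qs : list quantifier) (ns : list nat) (x : baire) : Prop :=
  match qs with
  | [] => theta ns x
  | Ex :: qs' => exists n, holds_at theta qs' (ns ++ [n]) x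
  | All :: qs' => forall n, holds_at theta qs' (ns ++ [n]) x
  | ExInf :: qs' =>
      forall m, exists n, m <= n /\ holds_at theta qs' (ns ++ [n]) x
  | AllInf :: qs' =>
      exists m, forall n, m <= n -> holds_at theta qs' (ns ++ [n]) x
  end.

Fixpoint witness_at (theta : list nat -> baire -> Prop)
    (qs : list quantifier) (ns : list nat) (x a : baire) : Prop :=
  match qs with
  | [] => (forall k, a k = fold_right pushed x ns k) /\ theta ns x
  | Ex :: qs' => witness_at theta qs' (ns ++ [a 0]) x (tail a)
  | All :: qs' => forall n, witness_at theta qs' (ns ++ [n]) x (section a n)
  | ExInf :: qs' =>
      forall n, n <= section a n 0 /\
        witness_at theta qs' (ns ++ [section a n 0]) x (tail (section a n))
  | AllInf :: qs' =>
      forall n, a 0 <= n ->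
        witness_at theta qs' (ns ++ [n]) x (section (tail a) n)
  end.

Definition holds (phi : formula) (x : baire) : Prop :=
  holds_at (matrix phi) (pattern phi) [] x.

Definition witness (phi : formula) (x a : baire) : Prop :=
  witness_at (matrix phi) (pattern phi) [] x a.

(** Instances are the computable [x]; then [y], the value at [x] of the
    functional [eta], is computable as well. *)
Definition m_reducible (phi psi : formula) : Prop :=
  exists eta r_minus r_plus : code,
  forall x, computable x ->
  exists y, maps_to eta x y /\
    (holds phi x <-> holds psi y) /\
    (forall a, witness phi x a ->
       exists b, maps_to r_minus (join a x) b /\ witness psi y b) /\
    (forall a, witness psi y a ->
       exists b, maps_to r_plus (join a x) b /\ witness phi x b).

(** ⟨Q_0 .. Q_l⟩ *)
Definition generic (qs : list quantifier) : formula :=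
  Formula qs (fun ns x => x (tuple_code ns) = 0).

(* Main.v *)
From Stdlib Require Import Arith Cantor List Lia.
Require Import Defs.
Import ListNotations.

(** In both formulas the threshold [t] of the outer quantifier is read off a
    witness after finitely many steps.  On the instance 0 with threshold 0, the
    functional [r_minus] yields a threshold [t'] for the image [y0], from which
    [r_plus] yields a threshold [T].  On the instance 0 with threshold [S T],
    [r_minus] yields [t2].  Let [x1] be nonzero exactly on the columns up to [T],
    far beyond everything inspected so far, and let [y1] be its image.  Then
    [S T] is still a threshold for [x1], so [t2] is one for [y1]; the finitely
    many columns of [y1] between [t'] and [t2] contain the zeros already seen in
    [y0], a single zero per column being enough.  Hence [t'] is a threshold for
    [y1], and [r_plus] again answers [T], although column [T] of [x1] has only
    finitely many zeros. *)

(** ** Use principle *)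

Definition agree (L : nat) (a b : baire) : Prop := forall i, i < L -> a i = b i.

Lemma agree_le (L M : nat) (a b : baire) : L <= M -> agree M a b -> agree L a b.
Proof. intros H Hab i Hi; apply Hab; lia. Qed.

Lemma uniform_bound (P : nat -> nat -> Prop) (v : nat) :
  (forall i L M, L <= M -> P i L -> P i M) ->
  (forall i, i < v -> exists L, P i L) ->
  exists L, forall i, i < v -> P i L.
Proof.
  intros mono; induction v as [|v IH]; intros H.
  - exists 0; lia.
  - destruct IH as [L HL]; [intros i Hi; apply H; lia|].
    destruct (H v) as [M HM]; [lia|].
    exists (max L M); intros i Hi.
    destruct (Nat.eq_dec i v) as [->|Hne].
    + apply mono with M; [lia|exact HM].
    + apply mono with L; [lia|apply HL; lia].
Qed.

(** A halting computation queries the oracle only finitely often. For [Min], [uniform_bound] merges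
    the bounds of the [v] failed tests. *)
Lemma eval_use (a : baire) (c : code) (n v : nat) :
  eval a c n v -> exists L, forall b, agree L a b -> eval b c n v.
Proof.
  induction 1 as [n|n|n|n|n|f g n u v _ [L HL] _ [M HM]
                 |f g n u v _ [L HL] _ [M HM]|f g p v _ [L HL]
                 |f g p i u v _ [L HL] _ [M HM]|f p v u _ [L HL] _ IH].
  1-4: exists 0; intros; constructor.
  - exists (S n); intros b Hb; rewrite (Hb n) by lia; constructor.
  - exists (max L M); intros b Hb; constructor;
      [apply HL|apply HM]; eapply agree_le; try eassumption; lia.
  - exists (max L M); intros b Hb; econstructor;
      [apply HL|apply HM]; eapply agree_le; try eassumption; lia.
  - exists L; intros b Hb; constructor; auto.
  - exists (max L M); intros b Hb; econstructor;
      [apply HL|apply HM]; eapply agree_le; try eassumption; lia.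
  - destruct (uniform_bound (fun i M => forall b, agree M a b ->
        eval b f (pair_code p i) (S (u i))) v) as [M HM].
    + intros i M M' Hle HM b Hb; apply HM; eapply agree_le; eassumption.
    + exact IH.
    + exists (max L M); intros b Hb; apply eval_Min with u.
      * apply HL; eapply agree_le; try eassumption; lia.
      * intros i Hi; apply HM; [exact Hi|].
        eapply agree_le; try eassumption; lia.
Qed.

Lemma pair_code_inj (n k n' k' : nat) :
  pair_code n k = pair_code n' k' -> n = n' /\ k = k'.
Proof. intros H; apply (to_nat_inj (n, k) (n', k')) in H; injection H; auto. Qed.

(** The input is a variable [q], so that inversion leaves an equation between codes that
    [pair_code_inj] can split. *)
Lemma eval_Prec_inv (a : baire) (f g : code) (q w : nat) :
  eval a (Prec f g) q w ->
  (exists p, q = pair_code p 0 /\ eval a f p w) \/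
  (exists p i u, q = pair_code p (S i) /\ eval a (Prec f g) (pair_code p i) u /\
     eval a g (pair_code p (pair_code i u)) w).
Proof. intros H; inversion H; subst; [left|right]; eauto 10. Qed.

(** For [Min], if two values differed, the test at the smaller one would be both zero and a
    successor. *)
Lemma eval_functional (a : baire) (c : code) (n v w : nat) :
  eval a c n v -> eval a c n w -> v = w.
Proof.
  intros H; revert w.
  induction H as [n|n|n|n|n|f g n u v _ IHf _ IHg
                 |f g n u v _ IHg _ IHf|f g p v _ IHf
                 |f g p i u v _ IHr _ IHg|f p v u _ IH0 _ IHS];
    intros w Hw;
    try (apply eval_Prec_inv in Hw
           as [(p' & E & Hf)|(p' & i' & u' & E & Hr & Hg)];
         apply pair_code_inj in E as [<- E]; try discriminate E);
    try (inversion Hw; subst; reflexivity).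
  - inversion Hw; subst; f_equal; auto.
  - inversion Hw as [| | | | | |? ? ? u' ? Hg Hf| | |]; subst.
    apply IHf; rewrite (IHg u'); assumption.
  - auto.
  - injection E as <-; apply IHg; rewrite (IHr u'); assumption.
  - inversion Hw as [| | | | | | | | |? ? ? u' H0 HS]; subst.
    destruct (Nat.lt_trichotomy v w) as [Hlt|[Heq|Hlt]].
    + specialize (IH0 _ (HS _ Hlt)); discriminate.
    + exact Heq.
    + specialize (IHS _ Hlt _ H0); discriminate.
Qed.

(** [eval_use] bounds each of the [K] computations; determinism then identifies their results with
    the values of [b']. *)
Lemma maps_to_continuous (c : code) (a b : baire) (K : nat) :
  maps_to c a b ->
  exists L, forall a' b', agree L a a' -> maps_to c a' b' -> agree K b b'.
Proof.
  intros H.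
  destruct (uniform_bound (fun i L => forall a', agree L a a' ->
      eval a' c i (b i)) K) as [L HL].
  - intros i L M Hle HL a' Ha'; apply HL; eapply agree_le; eassumption.
  - intros i _; apply eval_use, H.
  - exists L; intros a' b' Ha' Hb' i Hi.
    eapply eval_functional; [apply HL; eassumption|apply Hb'].
Qed.

Lemma agree_join (L : nat) (a b x y : baire) :
  agree L a b -> agree L x y -> agree L (join a x) (join b y).
Proof.
  intros Hab Hxy i Hi; unfold join.
  assert (Nat.div2 i <= i) by apply Nat.div2_decr, Nat.le_succ_diag_r.
  destruct (Nat.even i); [apply Hab|apply Hxy]; lia.
Qed.

Lemma agree_pushed (L t : nat) (a b : baire) :
  agree L a b -> agree L (pushed t a) (pushed t b).
Proof. intros H [|i] Hi; simpl; [reflexivity|apply H; lia]. Qed.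

(** ** Standard witnesses *)

Definition sections (f : nat -> baire) : baire :=
  fun i => let (n, k) := of_nat i in f n k.

Lemma section_sections (f : nat -> baire) (n k : nat) :
  section (sections f) n k = f n k.
Proof.
  unfold section, sections, pair_code; rewrite cancel_of_to; reflexivity.
Qed.

(** The code of a pair bounds both of its components. *)
Lemma agree_sections (L : nat) (f g : nat -> baire) :
  (forall n, n < L -> agree L (f n) (g n)) ->
  agree L (sections f) (sections g).
Proof.
  intros H i Hi; unfold sections.
  destruct (of_nat i) as [n k] eqn:E.
  pose proof (to_nat_non_decreasing n k) as Hle.
  rewrite <- E, cancel_to_of in Hle.
  apply H; lia.
Qed.

(** Meant for instances whose columns from [t] on vanish: the request for a zero at or beyond [m] is
    answered by [m] itself. The innermost [pushed n (pushed m x)] is the tuple that the matrix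
    requires. *)
Definition allinf_exinf_witness (t : nat) (x : baire) : baire :=
  pushed t (sections (fun n => sections (fun m => pushed m (pushed n (pushed m x))))).

Definition allinf_ex_witness (t : nat) (kappa : nat -> nat) (y : baire) : baire :=
  pushed t (sections (fun n => pushed (kappa n) (pushed n (pushed (kappa n) y)))).

Lemma agree_allinf_exinf_witness (L t : nat) (x x' : baire) :
  agree L x x' ->
  agree L (allinf_exinf_witness t x) (allinf_exinf_witness t x').
Proof.
  intros H; apply agree_pushed, agree_sections; intros n _.
  apply agree_sections; intros m _; now repeat apply agree_pushed.
Qed.

(** A prefix of length [L] meets only columns below [L], so the zeros chosen in later columns can be
    exchanged freely. *)
Lemma agree_allinf_ex_witness (L t : nat) (kappa kappa' : nat -> nat)
    (y y' : baire) :
  agree L kappa kappa' -> agree L y y' ->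
  agree L (allinf_ex_witness t kappa y) (allinf_ex_witness t kappa' y').
Proof.
  intros Hk Hy; apply agree_pushed, agree_sections; intros n Hn.
  rewrite (Hk n Hn); now repeat apply agree_pushed.
Qed.

Lemma allinf_exinf_witnessP (t : nat) (x : baire) :
  (forall n k, t <= n -> x (pair_code n k) = 0) ->
  witness (generic [AllInf; ExInf]) x (allinf_exinf_witness t x).
Proof.
  intros H n Hn m.
  assert (E : forall k,
      section (section (tail (allinf_exinf_witness t x)) n) m k
      = pushed m (pushed n (pushed m x)) k).
  { intros k; unfold section at 1.
    change (tail (allinf_exinf_witness t x)) with
      (sections (fun n => sections (fun m => pushed m (pushed n (pushed m x))))).
    rewrite section_sections; apply section_sections. }
  simpl in Hn; simpl; rewrite E; simpl; repeat split; auto.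
  intros k; unfold tail at 1; rewrite E; reflexivity.
Qed.

Lemma allinf_ex_witnessP (t : nat) (kappa : nat -> nat) (y : baire) :
  (forall n, t <= n -> y (pair_code n (kappa n)) = 0) ->
  witness (generic [AllInf; Ex]) y (allinf_ex_witness t kappa y).
Proof.
  intros H n Hn.
  assert (E : forall k, section (tail (allinf_ex_witness t kappa y)) n k
      = pushed (kappa n) (pushed n (pushed (kappa n) y)) k)
    by (intros k; apply section_sections).
  simpl in Hn; simpl; rewrite E; simpl; split; auto.
  intros k; unfold tail at 1; rewrite E; reflexivity.
Qed.

Lemma allinf_ex_zero (y b : baire) (n : nat) :
  witness (generic [AllInf; Ex]) y b -> b 0 <= n ->
  y (pair_code n (section (tail b) n 0)) = 0.
Proof. intros H Hn; exact (proj2 (H n Hn)). Qed.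

(** ** The modified instance *)

(** Indicator of the codes above [L] whose column is at most [T], phrased by truncated subtraction
    and zero tests, which [Prec] computes directly. *)
Definition late_columns (L T : nat) : baire :=
  fun m => match m - L with
           | 0 => 0
           | S _ => match fst (of_nat m) - T with 0 => 1 | S _ => 0 end
           end.

(** * Computability of the modified instance *)

Definition ident_code : code := Pair Left Right.

(** Recursion with dummy parameter 0, whose step returns its counter and discards the previous
    value. *)
Definition pred_code : code :=
  Comp (Prec Zero (Comp Left Right)) (Pair Zero ident_code).

Fixpoint sub_code (L : nat) : code :=
  match L with 0 => ident_code | S L' => Comp pred_code (sub_code L') end.

Lemma eval_ident (a : baire) (n : nat) : eval a ident_code n n.
Proof.
  assert (E : pair_code (fst (of_nat n)) (snd (of_nat n)) = n)
    by (unfold pair_code; rewrite <- surjective_pairing; apply cancel_to_of).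
  pose proof (eval_Pair a _ _ n _ _ (eval_Left a n) (eval_Right a n)) as H.
  rewrite E in H; exact H.
Qed.

Lemma eval_Prec_case (a : baire) (f g : code) (p i : nat) (h : nat -> nat) :
  eval a f p (h 0) ->
  (forall j, eval a g (pair_code p (pair_code j (h j))) (h (S j))) ->
  eval a (Prec f g) (pair_code p i) (h i).
Proof.
  intros H0 HS; induction i; [now constructor|econstructor; eauto].
Qed.

Lemma eval_left_pair (a : baire) (n k : nat) : eval a Left (pair_code n k) n.
Proof.
  pose proof (eval_Left a (pair_code n k)) as H.
  unfold pair_code in H at 2; rewrite cancel_of_to in H; exact H.
Qed.

Lemma eval_right_pair (a : baire) (n k : nat) : eval a Right (pair_code n k) k.
Proof.
  pose proof (eval_Right a (pair_code n k)) as H.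
  unfold pair_code in H at 2; rewrite cancel_of_to in H; exact H.
Qed.

Lemma eval_pred (a : baire) (n : nat) : eval a pred_code n (pred n).
Proof.
  eapply eval_Comp with (u := pair_code 0 n).
  - constructor; [constructor|apply eval_ident].
  - apply eval_Prec_case; [constructor|intros j].
    econstructor; [apply eval_right_pair|apply eval_left_pair].
Qed.

Lemma eval_sub (a : baire) (L n : nat) : eval a (sub_code L) n (n - L).
Proof.
  induction L as [|L IH].
  - rewrite Nat.sub_0_r; apply eval_ident.
  - rewrite Nat.sub_succ_r; econstructor; [exact IH|apply eval_pred].
Qed.

Lemma computable_late_columns (L T : nat) : computable (late_columns L T).
Proof.
  pose (column_code := Comp (Prec (Comp Succ Zero) Zero)
                            (Pair Zero (Comp (sub_code T) Left))).
  exists (Comp (Prec Zero (Comp column_code Left))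
               (Pair ident_code (sub_code L))).
  intros m.
  eapply eval_Comp with (u := pair_code m (m - L)).
  { constructor; [apply eval_ident|apply eval_sub]. }
  apply eval_Prec_case with (h := fun i => match i with 0 => 0
    | S _ => match fst (of_nat m) - T with 0 => 1 | S _ => 0 end end);
    [constructor|intros j].
  econstructor; [apply eval_left_pair|].
  eapply eval_Comp with (u := pair_code 0 (fst (of_nat m) - T)).
  { constructor; [constructor|].
    econstructor; [apply eval_Left|apply eval_sub]. }
  apply eval_Prec_case with (h := fun i => match i with 0 => 1 | S _ => 0 end).
  - econstructor; constructor.
  - intros; constructor.
Qed.

Lemma agree_late_columns (L T : nat) : agree L (fun _ => 0) (late_columns L T).
Proof.
  intros i Hi; unfold late_columns.
  replace (i - L) with 0 by lia; reflexivity.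
Qed.

Lemma late_columns_zero (L T n k : nat) :
  S T <= n -> late_columns L T (pair_code n k) = 0.
Proof.
  intros Hn; unfold late_columns, pair_code.
  rewrite cancel_of_to; simpl fst.
  destruct (_ - L); [reflexivity|].
  destruct (n - T) eqn:E; [lia|reflexivity].
Qed.

Lemma late_columns_one (L T k : nat) :
  L < k -> late_columns L T (pair_code T k) = 1.
Proof.
  intros Hk; unfold late_columns, pair_code.
  rewrite cancel_of_to; simpl fst; rewrite Nat.sub_diag.
  pose proof (to_nat_non_decreasing T k).
  destruct (to_nat (T, k) - L) eqn:E; [lia|reflexivity].
Qed.

(** A threshold [T] would cover column [T]; the zero then supplied at a position beyond [L]
    contradicts [late_columns_one]. *)
Lemma late_columns_threshold (L T : nat) (c : baire) :
  witness (generic [AllInf; ExInf]) (late_columns L T) c -> c 0 <> T.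
Proof.
  intros H E; destruct (H T (Nat.eq_le_incl _ _ E) (S L)) as [Hk [_ H0]].
  change (late_columns L T
    (pair_code T (section (section (tail c) T) (S L) 0)) = 0) in H0.
  rewrite late_columns_one in H0 by exact Hk; discriminate.
Qed.

Theorem theorem4p12 :
  ~ m_reducible (generic [AllInf; ExInf]) (generic [AllInf; Ex]).
Proof.
  intros (eta & r_minus & r_plus & H).
  pose (x0 := (fun _ => 0) : baire).
  destruct (H x0) as (y0 & Heta0 & _ & Hminus0 & Hplus0).
  { exists Zero; intros; constructor. }
  destruct (Hminus0 (allinf_exinf_witness 0 x0)) as (b0 & _ & Hb0).
  { apply allinf_exinf_witnessP; reflexivity. }
  set (kappa0 := fun n => section (tail b0) n 0).
  (* Only the threshold and one zero per column are kept from [b0], so that this witness can later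
     be altered column by column. *)
  destruct (Hplus0 (allinf_ex_witness (b0 0) kappa0 y0)) as (c0 & Hc0 & _).
  { apply allinf_ex_witnessP; intros n; apply allinf_ex_zero, Hb0. }
  set (T := c0 0).
  destruct (Hminus0 (allinf_exinf_witness (S T) x0)) as (b2 & Hb2 & _).
  { apply allinf_exinf_witnessP; reflexivity. }
  (* Length 1 suffices, since a threshold is entry 0 of a witness. *)
  destruct (maps_to_continuous _ _ _ 1 Hc0) as [L1 HL1].
  destruct (maps_to_continuous _ _ _ 1 Hb2) as [L2 HL2].
  (* Old zeros are kept below [L1] so that [r_plus] sees no change, and below [b2 0] because the new
     witness guarantees zeros only from there on. *)
  set (M := max L1 (b2 0)).
  destruct (uniform_bound (fun n K => pair_code n (kappa0 n) < K) M)
    as [K HK]; [lia|intros n _; eexists; apply Nat.lt_succ_diag_r|].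
  (* Agreement up to [K] preserves the kept zeros; agreement up to [L1] serves [r_plus], which also
     reads the altered witness built from the image. *)
  destruct (maps_to_continuous _ _ _ (max L1 K) Heta0) as [L3 HL3].
  set (L := max L1 (max L2 L3)).
  pose proof (agree_late_columns L T : agree L x0 _) as Hx.
  destruct (H (late_columns L T)) as (y1 & Heta1 & _ & Hminus1 & Hplus1).
  { apply computable_late_columns. }
  assert (Hy : agree (max L1 K) y0 y1).
  { apply (HL3 (late_columns L T)); [|exact Heta1].
    apply agree_le with L; [lia|exact Hx]. }
  destruct (Hminus1 (allinf_exinf_witness (S T) (late_columns L T)))
    as (b3 & Hb3 & Hw3).
  { apply allinf_exinf_witnessP; intros n k; apply late_columns_zero. }
  assert (E3 : b2 0 = b3 0).
  { eapply HL2; [|exact Hb3|lia].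
    apply agree_le with L; [lia|].
    apply agree_join; [apply agree_allinf_exinf_witness|]; exact Hx. }
  (* The splice: old zeros below [M], zeros from [b3] beyond, where [E3] puts every column past the
     threshold of [b3]. *)
  set (kappa1 := fun n => if n <? M then kappa0 n else section (tail b3) n 0).
  destruct (Hplus1 (allinf_ex_witness (b0 0) kappa1 y1)) as (c1 & Hc1 & Hw1).
  { apply allinf_ex_witnessP; intros n Hn; unfold kappa1.
    destruct (Nat.ltb_spec n M) as [HnM|HnM].
    - rewrite <- Hy by (specialize (HK n HnM); cbv beta in HK; lia).
      now apply allinf_ex_zero.
    - apply allinf_ex_zero; [exact Hw3|lia]. }
  (* It remains to see that [r_plus] repeats its answer [T], its two inputs being unchanged below
     [L1]. *)
  apply (late_columns_threshold _ _ _ Hw1); symmetry.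
  eapply HL1; [|exact Hc1|lia].
  apply agree_join; [apply agree_allinf_ex_witness|].
  - intros n Hn; unfold kappa1.
    destruct (Nat.ltb_spec n M); [reflexivity|lia].
  - apply agree_le with (max L1 K); [lia|exact Hy].
  - apply agree_le with L; [lia|exact Hx].
Qed.
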